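(* For each integer $g \geq 0$ there exists a centrally symmetric quadrangulated map on the orientable surface of genus $g$ with exactly $18g+26$ vertices.
   Context: A surface is a connected, compact 2-manifold without boundary. A map $M$ on a surface $S$ is an embedding in $S$ of a finite simple graph $G$, all of whose vertices have degree $\geq 3$, such that the closures of the components of $S\setminus G$ (called the faces of $M$) are closed 2-cells, i.e. each is homeomorphic to a 2-disk. A map is polyhedral if the intersection of any two distinct faces is either empty, a common vertex, or a common edge. A map is quadrangulated if all of its faces are quadrangles (4-gons). A polyhedral map $M$ is called centrally symmetric if it is invariant under an involution of its vertex set which fixes no face of $M$: the involution is an automorphism of $M$ of order two (mapping vertices, edges and 2-faces to vertices, edges and 2-faces) and no vertex, edge or 2-face is mapped to itself as a set. In particular the number of vertices is even, $2m$, and after labelling the vertices suitably the involution is $(1,2m)(2,2m-1)\cdots(m,m+1)$. *)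

(* Defs.v *)
From mathcomp Require Import all_boot all_fingroup all_algebra.

Set Implicit Arguments.
Unset Strict Implicit.
Unset Printing Implicit Defensive.

(* Maps on closed surfaces, encoded combinatorially (MathComp).               *)
(*                                                                            *)
(* A finite simple graph G on V embedded in a surface so that the closures of *)
(* the complementary regions are closed 2-cells is determined, up to          *)
(* homeomorphism, by its facial cycles: each region is bounded by a cycle of  *)
(* G, and the surface is recovered by gluing one disk to G along each of      *)
(* these cycles.  Conversely, gluing disks along a family of cycles of G      *)
(* yields a surface exactly when                                              *)
(*  - G is nonempty and connected (the glued space is nonempty, connected);   *)
(*  - every edge lies on exactly two of the cycles (the glued space is a      *)
(*    2-manifold without boundary at the points inside edges);                *)
(*  - at every vertex the link is a single circle (the same at vertices).     *)

Section Cycles.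
Variable V : finType.

(* A cycle is listed without repetition, up to rotation and reversal. *)
Definition cycle_edges (s : seq V) : {set {set V}} :=
  [set [set x; next s x] | x in s].

Definition traverses (s : seq V) (u v : V) : bool :=
  (u \in s) && (next s u == v).

(* For a family of cycles bdry, u and w are joined in the link of v when one  *)
(* of the cycles passes through v along the edges uv and vw.                  *)
Definition link_rel (F : finType) (bdry : F -> seq V) (v : V) : rel V :=
  fun u w => [exists f : F, [&& u != w,
    [set v; u] \in cycle_edges (bdry f) & [set v; w] \in cycle_edges (bdry f)]].

End Cycles.

(* Edges are two-element sets of vertices, so the graph is simple.            *)
(* Under map_edge_faces the link of v is a 2-regular multigraph on the        *)
(* neighbours of v, of which there are at least three by map_degree; it is    *)
(* therefore a circle as soon as it is connected, which is map_link.          *)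
Record surface_map (V F : finType) := SurfaceMap {
  map_edges : {set {set V}};
  map_bdry : F -> seq V;
  map_edge_card : forall e, e \in map_edges -> #|e| = 2;
  map_nonempty : 0 < #|V|;
  map_connected : forall u v : V,
    connect (fun x y => [set x; y] \in map_edges) u v;
  map_degree : forall v : V, 3 <= #|[set e in map_edges | v \in e]|;
  map_bdry_uniq : forall f, uniq (map_bdry f);
  map_bdry_size : forall f, 3 <= size (map_bdry f);
  map_bdry_sub : forall f, cycle_edges (map_bdry f) \subset map_edges;
  map_edge_faces : forall e, e \in map_edges ->
    #|[set f | e \in cycle_edges (map_bdry f)]| = 2;
  map_link : forall v u w : V,
    [set v; u] \in map_edges -> [set v; w] \in map_edges ->
    connect (link_rel map_bdry v) u w
}.

Section MapProperties.
Variables (V F : finType) (M : surface_map V F).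

Definition face_vertices (f : F) : {set V} := [set x in map_bdry M f].

Definition face_edges (f : F) : {set {set V}} := cycle_edges (map_bdry M f).

Definition polyhedral : Prop :=
  forall f f' : F, f != f' ->
  [\/ face_vertices f :&: face_vertices f' = set0,
      exists v, face_vertices f :&: face_vertices f' = [set v]
    | exists2 e, e \in face_edges f :&: face_edges f' &
        face_vertices f :&: face_vertices f' = e].

Definition quadrangulated : Prop := forall f : F, size (map_bdry M f) = 4.

(* o f tells whether the direction in which map_bdry M f is listed is         *)
(* reversed; the two faces at an edge must traverse it in opposite directions.*)
Definition orientable : Prop :=
  exists o : F -> bool, forall (f f' : F) (u v : V), f != f' ->
    let along h := if o h then traverses (map_bdry M h) v u
                   else traverses (map_bdry M h) u v in
    ~~ (along f && along f').

Definition euler_char : int :=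
  (#|V|%:Z - #|map_edges M|%:Z + #|F|%:Z)%R.

(* By the classification of closed surfaces, orientability and Euler          *)
(* characteristic 2 - 2g determine the surface up to homeomorphism.           *)
Definition on_orientable_surface_of_genus (g : nat) : Prop :=
  orientable /\ (euler_char = 2 - 2 * g%:Z)%R.

(* As a cycle is determined by its edge set, a permutation s of the vertices  *)
(* sends the face f to the face f' when it sends the edge set of f to that    *)
(* of f'.                                                                     *)
Definition edges_image (s : {perm V}) (A : {set {set V}}) : {set {set V}} :=
  [set s @: (e : {set V}) | e in A].

Definition automorphism (s : {perm V}) : Prop :=
  edges_image s (map_edges M) = map_edges M /\
  forall f, exists f', edges_image s (face_edges f) = face_edges f'.

(* Only polyhedral maps are called centrally symmetric. *)
Definition centrally_symmetric : Prop :=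
  polyhedral /\
  exists s : {perm V},
    [/\ automorphism s, #[s]%g = 2,
        forall v, s v != v,
        forall e : {set V}, e \in map_edges M -> s @: e != e
      & forall f, edges_image s (face_edges f) != face_edges f].

End MapProperties.

(* Main.v *)
Require Import Defs.
From mathcomp Require Import all_boot all_fingroup all_algebra.
From mathcomp Require Import cyclic zify ring.

Set Implicit Arguments.
Unset Strict Implicit.
Unset Printing Implicit Defensive.

Import GRing.Theory.

(** The map is the orientable double cover of a sphere with [g + 1] crosscaps.

    Start with a quadrangulation of the sphere, here called the helix: the
    vertices are 0, ..., 9g + 12, the quadrangles (i, i+1, i+6, i+5) wind up
    around a tube, and a diagonal splits each of the two hexagons in which the
    tube ends.  It has 9g + 13 vertices and 9g + 11 faces.  Choose the g + 1
    faces with i = 0, 9, ..., 9g; they are pairwise disjoint.  Take two copies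
    of the sphere, a top and a bottom one, remove the chosen faces from both,
    and for each chosen face v0 v1 v2 v3 join the two boundaries by a tube with
    a half turn, whose four faces are (v_i, v_(i+1), v_(i+3)', v_(i+2)'), the
    primes marking the bottom copy.  The involution exchanges the two copies of
    every vertex.  The four corners of any face lie over four different vertices
    of the sphere, so that no vertex, edge or face is invariant.

    There are 2(9g + 13) = 18g + 26 vertices; each of the g + 1 chosen faces
    accounts for 4 faces instead of 2, hence there are 2(9g + 11) + 2(g + 1)
    = 20g + 24 faces, and twice as many edges.  The Euler characteristic is
    therefore 2 - 2g.

    Everything else rests on one notion, [coherent_quads].  A family of cyclically
    indexed quadrangles is coherent when every side is also a side, reversed,
    of some face, and a face is determined by any ordered pair of its corners
    that is a side in the cyclic direction or a diagonal.  The latter says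
    three things at once: no two faces lie on the same side of an edge, which
    is orientability and bounds by two the number of faces at an edge; two
    faces that share two vertices share them as an edge, which is polyhedrality;
    and all components of vertex links have at least three elements
    ([link_component_ge3]), so that links are connected as soon as degrees are
    at most 5 ([quad_link]).  Coherence is proved for the helix in
    [helix_coherent], by computing a face from a pair of corners, and passes to
    the double in [double_coherent].  The degrees are at most 4 in the helix and
    grow by at most one in the double, since the chosen faces are disjoint. *)

Lemma set2_eq (T : finType) (u v a b : T) :
  [set u; v] = [set a; b] -> (u = a /\ v = b) \/ (u = b /\ v = a).
Proof.
move=> E.
have /set2P hu : u \in [set a; b] by rewrite -E set21.
have /set2P hv : v \in [set a; b] by rewrite -E set22.
have /set2P ha : a \in [set u; v] by rewrite E set21.
have /set2P hb : b \in [set u; v] by rewrite E set22.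
by case: hu => hu; case: hv => hv; case: ha => ha; case: hb => hb; subst; auto.
Qed.

Local Open Scope ring_scope.

(** * Coherent families of quadrangles and their maps *)

Section CoherentQuads.
Variables V F : finType.

Implicit Types (c : F -> 'I_4 -> V) (d : 'I_4).

(** The corners are indexed by integers modulo 4, so that [i + 1] is the next
    corner and [i + 2] the opposite one.  Allowing the steps [d] and [d'] to
    differ excludes that a side of one face is a diagonal of another; the
    step 3 is left out because a side and its reverse belong to two faces. *)
Record coherent_quads c : Prop := CoherentQuads {
  quad_inj : forall f, injective (c f);
  quad_eq : forall f f' i j d d', d \in [:: 1; 2%:R] -> d' \in [:: 1; 2%:R] ->
    c f i = c f' j -> c f (i + d) = c f' (j + d') -> f = f';
  quad_rev : forall f i, exists f' j,
    c f' j = c f (i + 1) /\ c f' (j + 1) = c f i }.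

Definition quad_arc c (u v : V) : bool :=
  [exists f, exists i, (c f i == u) && (c f (i + 1) == v)].

Lemma quad_arcP c u v :
  reflect (exists f i, c f i = u /\ c f (i + 1) = v) (quad_arc c u v).
Proof.
apply: (iffP existsP) => [[f /existsP[i /andP[/eqP <- /eqP <-]]]|[f [i [<- <-]]]].
  by exists f, i.
by exists f; apply/existsP; exists i; rewrite !eqxx.
Qed.

Definition quad_bdry c f : seq V := [seq c f i | i : 'I_4 <- [:: 0; 1; 2%:R; 3%:R]].

Variables (c : F -> 'I_4 -> V) (cohc : coherent_quads c).

Let cI := quad_inj cohc.

Lemma quad_arc_sym u v : quad_arc c u v = quad_arc c v u.
Proof.
suff sub x y : quad_arc c x y -> quad_arc c y x by apply/idP/idP; apply: sub.
case/quad_arcP=> f [i [<- <-]]; apply/quad_arcP.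
by have [f' [j [? ?]]] := quad_rev cohc f i; exists f', j.
Qed.

Lemma mem_quad_index (i : 'I_4) : i \in [:: 0; 1; 2%:R; 3%:R : 'I_4].
Proof. by case: i => [[|[|[|[|]]]]]. Qed.

Lemma quad_bdryP f v : reflect (exists i, v = c f i) (v \in quad_bdry c f).
Proof.
apply: (iffP mapP) => [[i _ ->]|[i ->]]; first by exists i.
by exists i => //; apply: mem_quad_index.
Qed.

Lemma quad_bdry_uniq f : uniq (quad_bdry c f).
Proof. by rewrite map_inj_uniq. Qed.

Lemma next_quad_bdry f i : next (quad_bdry c f) (c f i) = c f (i + 1).
Proof.
rewrite next_map //; congr c.
by case: i => [[|[|[|[|]]]] //= ?]; apply/val_inj; vm_compute.
Qed.

Lemma traversesP f u v :
  reflect (exists i, u = c f i /\ v = c f (i + 1)) (traverses (quad_bdry c f) u v).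
Proof.
apply: (iffP andP) => [[/quad_bdryP[i ->]]|[i [-> ->]]].
  by rewrite next_quad_bdry => /eqP <-; exists i.
by split; [apply/quad_bdryP; exists i|rewrite next_quad_bdry].
Qed.

Lemma quad_edgesP f (e : {set V}) :
  reflect (exists i, e = [set c f i; c f (i + 1)])
          (e \in cycle_edges (quad_bdry c f)).
Proof.
apply: (iffP imsetP) => [[x /quad_bdryP[i ->] ->]|[i ->]].
  by rewrite next_quad_bdry; exists i.
by exists (c f i); rewrite ?next_quad_bdry //; apply/quad_bdryP; exists i.
Qed.

Definition quad_edges : {set {set V}} :=
  \bigcup_f cycle_edges (quad_bdry c f).

Lemma mem_quad_edges u v : ([set u; v] \in quad_edges) = quad_arc c u v.
Proof.
apply/bigcupP/quad_arcP => [[f _ /quad_edgesP[i /set2_eq[[-> ->]|[-> ->]]]]|].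
- by exists f, i.
- have [f' [j [e1 e2]]] := quad_rev cohc f i.
  by exists f', j; rewrite e1 e2.
by case=> f [i [<- <-]]; exists f => //; apply/quad_edgesP; exists i.
Qed.

Lemma quad_edges_arc e : e \in quad_edges -> exists f i, e = [set c f i; c f (i + 1)].
Proof. by case/bigcupP=> f _ /quad_edgesP[i ->]; exists f, i. Qed.

Lemma neq_side f i : c f i != c f (i + 1).
Proof. by apply/eqP => /cI; case: i => [[|[|[|[|]]]]] // ? /(congr1 val). Qed.

Lemma quad_rev_neq f f' i j :
  c f' j = c f (i + 1) -> c f' (j + 1) = c f i -> f != f'.
Proof.
move=> e1 e2; apply/eqP => ff'; move: e1 e2; rewrite -ff' => /cI -> /cI.
by case: i => [[|[|[|[|]]]]] // ? /(congr1 val).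
Qed.

(** The two faces at an edge are those that traverse it in either direction. *)
Lemma card_edge_faces e : e \in quad_edges ->
  #|[set f | e \in cycle_edges (quad_bdry c f)]| = 2%N.
Proof.
case/quad_edges_arc=> f [i ->].
have [f' [j [e1 e2]]] := quad_rev cohc f i.
have neq := quad_rev_neq e1 e2.
suff -> : [set h | [set c f i; c f (i + 1)] \in cycle_edges (quad_bdry c h)] = [set f; f'].
  by rewrite cards2 neq.
apply/setP=> h; rewrite !inE; apply/quad_edgesP/orP; last first.
  case=> /eqP->; first by exists i.
  by exists j; rewrite e1 e2 setUC.
case=> k /set2_eq[[a b]|[a b]]; [left|right]; apply/eqP.
  by apply: (quad_eq cohc (d := 1) (d' := 1) _ _ (esym a)).
by apply: (quad_eq cohc (i := k) (j := j) (d := 1) (d' := 1)) => //; rewrite ?e1 ?e2.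
Qed.

(** Double counting of the incidences between edges and faces: two at each
    edge, four at each face. *)
Lemma card_quad_edges : #|quad_edges| = (2 * #|F|)%N.
Proof.
have cardE f : #|cycle_edges (quad_bdry c f)| = 4%N.
  rewrite card_in_imset; first by rewrite (card_uniqP (quad_bdry_uniq f)).
  move=> _ _ /quad_bdryP[i ->] /quad_bdryP[j ->]; rewrite !next_quad_bdry.
  case/set2_eq=> [[//]|[/cI -> /cI]].
  by case: j => [[|[|[|[|]]]]] // ? /(congr1 val).
suff : (#|quad_edges| * 2 = #|F| * 4)%N by lia.
rewrite -!sum_nat_const.
transitivity (\sum_(e in quad_edges) \sum_(f | e \in cycle_edges (quad_bdry c f)) 1)%N.
  by apply: eq_bigr => e eE; rewrite -(card_edge_faces eE) sum1dep_card.
rewrite (exchange_big_dep predT) //=; apply: eq_bigr => f _.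
rewrite -(cardE f) sum1dep_card; apply: eq_card => e; rewrite !inE.
by apply/andb_idl => ef; apply/bigcupP; exists f.
Qed.

Definition degree_at v := #|[set u | quad_arc c v u]|.

Lemma link_step v u w f (i : 'I_4) : c f i = v -> c f (i + 1) = u -> c f (i - 1) = w ->
  link_rel (quad_bdry c) v u w.
Proof.
move=> <- <- <-; apply/existsP; exists f; apply/and3P; split.
- by apply/eqP=> /cI; case: i => [[|[|[|[|]]]]] // ? /(congr1 val).
- by apply/quad_edgesP; exists i.
- by apply/quad_edgesP; exists (i - 1); rewrite subrK setUC.
Qed.

Lemma link_rel_sym v : symmetric (link_rel (quad_bdry c) v).
Proof.
move=> u w; apply/existsP/existsP => -[f /and3P[? ? ?]]; exists f.
  by rewrite eq_sym; apply/and3P.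
by rewrite eq_sym; apply/and3P.
Qed.

Definition link_component v u :=
  [set w | connect (link_rel (quad_bdry c) v) u w & quad_arc c v w].

(** The faces on the two sides of [vu] lead from [u] to two other neighbours of
    [v].  If these coincided, the two faces would share a diagonal. *)
Lemma link_component_ge3 v u : quad_arc c v u -> (3 <= #|link_component v u|)%N.
Proof.
move=> vu; have [f [i [fv fu]]] := quad_arcP _ _ _ vu.
have [f' [j [f'u f'v]]] := quad_rev cohc f i; rewrite fu fv in f'u f'v.
have arcP1 : quad_arc c v (c f (i - 1)).
  by rewrite quad_arc_sym; apply/quad_arcP; exists f, (i - 1); rewrite subrK.
have arcP2 : quad_arc c v (c f' (j + 1 + 1)) by apply/quad_arcP; exists f', (j + 1).
have lp := link_step fv fu (erefl _).
have lq : link_rel (quad_bdry c) v u (c f' (j + 1 + 1)).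
  by rewrite link_rel_sym; apply: (link_step f'v) => //; rewrite addrK.
have up : u != c f (i - 1) by case/existsP: lp => ? /andP[].
have uq : u != c f' (j + 1 + 1) by case/existsP: lq => ? /andP[].
have pq : c f (i - 1) != c f' (j + 1 + 1).
  apply/eqP => e; have : f <> f'.
    by apply/eqP; apply: (@quad_rev_neq f f' i j); rewrite ?f'u ?f'v.
  apply.
  apply: (quad_eq cohc (i := i + 1) (j := j) (d := 2%:R) (d' := 2%:R)) => //.
    by rewrite fu f'u.
  rewrite (_ : i + 1 + 2%:R = i - 1) ?e; last first.
    by apply/val_inj; case: i {fv fu lp up arcP1 e} => [[|[|[|[|]]]]].
  by rewrite -addrA.
apply: (@leq_trans #|[set u; c f (i - 1); c f' (j + 1 + 1)]|).
  by rewrite setUC cardsU1 cards2 !inE negb_or up (eq_sym _ u) (eq_sym _ (c f _)) uq pq.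
apply/subset_leq_card/subsetP => x; rewrite !inE => /orP[/orP[]|] /eqP ->.
- by rewrite connect0.
- by rewrite connect1.
- by rewrite connect1.
Qed.

Lemma quad_degree v : (exists u, quad_arc c v u) ->
  (3 <= #|[set e in quad_edges | v \in e]|)%N.
Proof.
case=> u vu; apply: leq_trans (link_component_ge3 vu) _.
have inj : {in link_component v u &, injective (fun w => [set v; w])}.
  move=> x y; rewrite !inE => /andP[_ vx] /andP[_ vy] /set2_eq[[//]|[-> ->//]].
rewrite -(card_in_imset inj); apply: subset_leq_card; apply/subsetP => _ /imsetP[w + ->].
by rewrite !inE eqxx mem_quad_edges andbT => /andP[].
Qed.

(** Two components would have at least 3 + 3 elements. *)
Lemma quad_link v u w : (degree_at v <= 5)%N ->
  [set v; u] \in quad_edges -> [set v; w] \in quad_edges ->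
  connect (link_rel (quad_bdry c) v) u w.
Proof.
rewrite !mem_quad_edges => deg vu vw; apply: contraLR deg => nc; rewrite -ltnNge.
have disj : [disjoint link_component v u & link_component v w].
  apply/pred0P => x /=; apply/negP; rewrite !inE => /andP[/andP[ux _] /andP[wx _]].
  case/negP: nc; apply: connect_trans ux _.
  by rewrite (sym_connect_sym (link_rel_sym v)).
have := leq_add (link_component_ge3 vu) (link_component_ge3 vw).
move/leq_trans; apply; rewrite -cardsUI (eqP (_ : _ :&: _ == set0)) ?setI_eq0 //.
rewrite cards0 addn0.
by apply/subset_leq_card/subsetP => x; rewrite !inE => /orP[] /andP[].
Qed.

Lemma quad_map_exists : (0 < #|V|)%N -> (forall u v, connect (quad_arc c) u v) ->
  (forall v, exists u, quad_arc c v u) -> (forall v, (degree_at v <= 5)%N) ->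
  exists M : surface_map V F, map_edges M = quad_edges /\ map_bdry M = quad_bdry c.
Proof.
move=> V0 conn ex deg.
unshelve eexists (@SurfaceMap V F quad_edges (quad_bdry c) _ V0 _ _ _ _ _ _ _).
- by move=> e /quad_edges_arc[f [i ->]]; rewrite cards2 neq_side.
- by move=> u v; rewrite (eq_connect (e' := quad_arc c)) // => x y; rewrite mem_quad_edges.
- by move=> v; apply: quad_degree.
- exact: quad_bdry_uniq.
- by [].
- by move=> f; apply: bigcup_sup.
- exact: card_edge_faces.
- by move=> v u w; apply: quad_link.
- by [].
Qed.

Section Properties.
Variable M : surface_map V F.
Hypothesis (ME : map_edges M = quad_edges) (MB : map_bdry M = quad_bdry c).

Lemma quad_map_quadrangulated : quadrangulated M.
Proof. by move=> f; rewrite MB. Qed.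

Lemma quad_map_orientable : orientable M.
Proof.
exists (fun=> false) => f f' u v ff'; rewrite MB /=.
apply/negP => /andP[/traversesP[i [-> ->]] /traversesP[j [e e']]].
by case/eqP: ff'; apply: (quad_eq cohc (d := 1) (d' := 1) _ _ e e').
Qed.

Lemma mem_face_vertices f v : (v \in face_vertices M f) = (v \in codom (c f)).
Proof.
rewrite inE MB.
by apply/quad_bdryP/codomP.
Qed.

(** Were [i] and [j] opposite in [f], the pair would determine [f] in both
    orders, while at least one of the orders is a step 1 or 2 in [f']. *)
Lemma common_vertices f f' i j k l :
  f != f' -> c f i = c f' k -> c f j = c f' l -> i != j ->
  j \in [:: i + 1; i - 1].
Proof.
move=> ff' e1 e2 ij; rewrite !inE; apply: contraR ff' => nadj.
have ji : j = i + 2%:R.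
  apply/val_inj; move: ij nadj; clear.
  by case: i => [[|[|[|[|]]]]] //; case: j => [[|[|[|[|]]]]].
have ij2 : i = j + 2%:R 
  by rewrite ji -addrA (_ : 2%:R + 2%:R = 0) ?addr0 //; apply/val_inj.
have kl : k != l by apply: contra ij => /eqP kl; apply/eqP/(@cI f); rewrite e1 e2 kl.
have [/eqP lk|/eqP lk|/eqP lk] : [\/ l == k + 1, l == k + 2%:R | k == l + 1].
  apply/or3P; move: kl; clear.
  by case: k => [[|[|[|[|]]]]] //; case: l => [[|[|[|[|]]]]].
- by apply/eqP; apply: (quad_eq cohc (d := 2%:R) (d' := 1) _ _ e1); rewrite // -?ji -?lk.
- by apply/eqP; apply: (quad_eq cohc (d := 2%:R) (d' := 2%:R) _ _ e1); rewrite // -?ji -?lk.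
- by apply/eqP; apply: (quad_eq cohc (d := 2%:R) (d' := 1) _ _ e2); rewrite // -?ij2 -?lk.
Qed.

Lemma quad_side f i j : j \in [:: i + 1; i - 1] ->
  [set c f i; c f j] \in face_edges M f.
Proof.
rewrite /face_edges MB !inE => /orP[]/eqP->; apply/quad_edgesP; first by exists i.
by exists (i - 1); rewrite subrK setUC.
Qed.

Lemma quad_map_polyhedral : polyhedral M.
Proof.
move=> f f' ff'; set I := _ :&: _.
have IP x : x \in I -> exists i k, x = c f i /\ x = c f' k.
  by rewrite inE !mem_face_vertices => /andP[/codomP[i ?] /codomP[k ?]]; exists i, k.
have [->|[u uI]] := set_0Vmem I; first by constructor 1.
have [Iu|] := eqVneq I [set u]; first by constructor 2; exists u.
rewrite eqEsubset sub1set uI andbT => /subsetPn[v vI]; rewrite inE => vu.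
have [i [k [ui uk]]] := IP u uI; have [j [l [vj vl]]] := IP v vI.
have ij : i != j by apply: contraNneq vu => e; rewrite ui vj e.
have kl : k != l by apply: contraNneq vu => e; rewrite uk vl e.
have eik : c f i = c f' k by rewrite -ui.
have ejl : c f j = c f' l by rewrite -vj.
constructor 3; exists [set u; v].
  rewrite inE {1}ui {1}vj uk vl !quad_side //.
    by apply: (@common_vertices f' f k l i j); rewrite // eq_sym.
  exact: (common_vertices ff' eik ejl).
(* A third common vertex would be adjacent to both u and v, but a quadrangle
   contains no triangle. *)
apply/setP => x; rewrite in_set2; apply/idP/orP => [xI|[]/eqP-> //].
have [h [h' [xh xh']]] := IP x xI; have eh : c f h = c f' h' by rewrite -xh.
have [ih|ih] := eqVneq i h; first by left; rewrite xh ui ih.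
have [jh|jh] := eqVneq j h; first by right; rewrite xh vj jh.
have := common_vertices ff' eik ejl ij; have := common_vertices ff' eik eh ih.
have := common_vertices ff' ejl eh jh; move: ij ih jh; clear.
by case: i => [[|[|[|[|]]]]] //; case: j => [[|[|[|[|]]]]] //;
  case: h => [[|[|[|[|]]]]].
Qed.

(** The involution reverses the cyclic direction of the faces, which is why the
    index [i] goes to [- i - 1]: side [i, i + 1] goes to side [j, j + 1] with
    [j = - i - 2].  A fixed edge or face would contain two vertices exchanged by
    the involution. *)
Lemma quad_map_centrally_symmetric (s : V -> V) (t : F -> F) :
  (0 < #|V|)%N -> involutive s ->
  (forall f i, s (c f i) = c (t f) (- i - 1)) ->
  (forall f i j, s (c f i) != c f j) ->
  (forall v, exists u, quad_arc c v u) ->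
  centrally_symmetric M.
Proof.
move=> V0 sK st free ex; split; first exact: quad_map_polyhedral.
have imface f : edges_image (perm (inv_inj sK)) (face_edges M f) = face_edges M (t f).
  apply/setP=> e; rewrite /face_edges MB; apply/imsetP/quad_edgesP.
    case=> _ /quad_edgesP[i ->] ->; exists (- i - 1 - 1).
    by rewrite imsetU !imset_set1 !permE !st subrK opprD setUC.
  case=> i ->; exists [set c f (- i - 1 - 1); c f (- i - 1)].
    by apply/quad_edgesP; exists (- i - 1 - 1); rewrite subrK.
  rewrite imsetU !imset_set1 !permE !st setUC; congr [set c _ _; c _ _]; ring.
have sfree v : s v != v.
  by have [u /quad_arcP[f [i [<- _]]]] := ex v; apply: free.
exists (perm (inv_inj sK)); split.
- split=> [|f]; last by exists (t f).
  apply/eqP; rewrite eqEcard (card_imset _ (@imset_inj _ _ _ perm_inj)) leqnn andbT ME.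
  apply/subsetP => _ /imsetP[e /bigcupP[f _ ef] ->]; apply/bigcupP; exists (t f) => //.
  by have := imface f; rewrite /face_edges MB => <-; apply: imset_f.
- apply: nt_prime_order => //.
    by apply/permP => v; rewrite expgS expg1 permM !permE sK.
  have /card_gt0P[v0 _] := V0.
  by apply: contraNneq (sfree v0) => /permP/(_ v0); rewrite !permE => ->.
- by move=> v; rewrite permE.
- move=> e; rewrite ME => /quad_edges_arc[f [i ->]]; apply/eqP => /setP/(_ (s (c f i))).
  rewrite !inE !(negPf (free _ _ _)) imsetU !imset_set1 !permE.
  by rewrite !inE eqxx.
- move=> f; rewrite imface /face_edges MB; apply/eqP => /setP/(_ [set c f 0; c f (0 + 1)]).
  have -> : [set c f 0; c f (0 + 1)] \in cycle_edges (quad_bdry c f).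
    by apply/quad_edgesP; exists 0.
  have tf k : c (t f) k = s (c f (- k - 1)) by rewrite st; congr c; rewrite opprD !opprK addrK.
  case/quad_edgesP => i /setP/(_ (c f 0)).
  by rewrite !inE eqxx !tf !(eq_sym (c f 0)) !(negPf (free _ _ _)).
Qed.

End Properties.

End CoherentQuads.

(** * Doubling along disjoint faces *)

Lemma z4_11 : 1 + 1 = 2%:R :> 'I_4. Proof. exact/val_inj. Qed.
Lemma z4_21 : 2%:R + 1 = 3%:R :> 'I_4. Proof. exact/val_inj. Qed.
Lemma z4_31 : 3%:R + 1 = 0 :> 'I_4. Proof. exact/val_inj. Qed.

Lemma z4_add12 (k : 'I_4) : k + 1 + 2%:R = k + 3%:R.
Proof. by rewrite -addrA; congr (k + _); apply/val_inj. Qed.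
Lemma z4_add21 (k : 'I_4) : k + 2%:R + 1 = k + 3%:R.
Proof. by rewrite -addrA; congr (k + _); apply/val_inj. Qed.
Lemma z4_add22 (k : 'I_4) : k + 2%:R + 2%:R = k.
Proof. by rewrite -addrA -[RHS]addr0; congr (k + _); apply/val_inj. Qed.
Lemma z4_add23 (k : 'I_4) : k + 2%:R + 3%:R = k + 1.
Proof. by rewrite -addrA; congr (k + _); apply/val_inj. Qed.
Lemma z4_addN13 (k : 'I_4) : k - 1 + 3%:R = k + 2%:R.
Proof. by rewrite -addrA; congr (k + _); apply/val_inj. Qed.

Section Doubling.
Variables (V F : finType) (c : F -> 'I_4 -> V) (holes : {set F}).
Hypothesis cohc : coherent_quads c.
Hypothesis holes_disjoint : {in holes &, forall f f' i j, c f i = c f' j -> f = f'}.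

(** A face outside [holes] appears once on each side, [false] being the top and
    [true] the bottom; a face in [holes] yields the four faces of a tube. *)
Definition double_face : finType :=
  ((bool * {f | f \notin holes}) + ({f | f \in holes} * 'I_4))%type.

(** The reindexing 0, 1, 3, 2 of the corners of a tube face: the last two are on
    the bottom, opposite to the first two. *)
Definition twist (k : 'I_4) : 'I_4 := if (k < 2)%N then k else 1 - k.

(** On the bottom the faces are listed backwards, because the involution reverses
    the orientation. *)
Definition doubled (h : double_face) (k : 'I_4) : bool * V :=
  match h with
  | inl (b, f) => (b, c (val f) (if b then - k - 1 else k))
  | inr (f, i) => ((2 <= k)%N, c (val f) (i + twist k))
  end.

Definition base_face (h : double_face) : F :=
  match h with inl (_, f) => val f | inr (f, _) => val f end.

Lemma twist_inj : injective twist.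
Proof. by case=> [[|[|[|[|]]]] //= ?] [[|[|[|[|]]]] //= ?] /(congr1 val) //= _; apply/val_inj. Qed.

Lemma twist_rev k : twist (- k - 1) = 2%:R + twist k.
Proof. by case: k => [[|[|[|[|]]]] //= ?]; apply/val_inj. Qed.

Lemma side_rev (k : 'I_4) : (2 <= (- k - 1)%R)%N = ~~ (2 <= k)%N.
Proof. by case: k => [[|[|[|[|]]]]]. Qed.

(** When two steps in tubes over the same face agree, eliminating the unknown
    indices of the two tube faces leaves the last equation. *)
Lemma twist_step (k k' d d' : 'I_4) :
  d \in [:: 1; 2%:R] -> d' \in [:: 1; 2%:R] ->
  (2 <= k)%N = (2 <= k')%N -> (2 <= (k + d)%R)%N = (2 <= (k' + d')%R)%N ->
  twist k - twist k' = twist (k + d) - twist (k' + d') -> k = k'.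
Proof.
rewrite !inE => /orP[]/eqP-> /orP[]/eqP->;
case: k => [[|[|[|[|]]]] // ?]; case: k' => [[|[|[|[|]]]] // ?] //= _ _ /(congr1 val);
 move=> e; try (by apply/val_inj); by vm_compute in e.
Qed.

(** A step that stays on one side is a step of the same length in the sphere,
    taken backwards on the bottom. *)
Lemma double_same_side h (i d : 'I_4) : d \in [:: 1; 2%:R] ->
  (doubled h i).1 = (doubled h (i + d)).1 ->
  let b := (doubled h i).1 in
  exists2 j, doubled h i = (b, c (base_face h) (if b then j + d else j))
           & doubled h (i + d) = (b, c (base_face h) (if b then j else j + d)).
Proof.
move=> dP; case: h => [[b f]|[f k]] /=.
  move=> _; exists (if b then - (i + d) - 1 else i); case: b => //; do 2?congr (_, c _ _); ring.
move=> side.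
have [-> [->|->]] : d = 1 /\ (i = 0 \/ i = 2%:R).
  move: dP side; rewrite !inE; clear.
  by case: i => [[|[|[|[|]]]] // ?] /orP[]/eqP-> // _; split; auto; [left|right]; apply/val_inj.
  exists k; rewrite [(2 <= _)%N]/=; congr (_, c _ _); last by congr (k + _); apply/val_inj.
  by rewrite -[RHS]addr0; congr (k + _); apply/val_inj.
exists (k + 2%:R); rewrite [(2 <= _)%N]/= -?addrA; congr (_, c _ (k + _)); apply/val_inj => //.
Qed.

(** A step that changes sides occurs only in a tube, and tubes over different
    faces are disjoint. *)
Lemma base_face_eq h h' i j d d' : d \in [:: 1; 2%:R] -> d' \in [:: 1; 2%:R] ->
  doubled h i = doubled h' j -> doubled h (i + d) = doubled h' (j + d') ->
  base_face h = base_face h'.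
Proof.
move=> dP dP' e1 e2.
have [same|/eqP diff] := eqVneq (doubled h i).1 (doubled h (i + d)).1.
  have same' : (doubled h' j).1 = (doubled h' (j + d')).1 by rewrite -e1 -e2.
  have [k a b] := double_same_side dP same.
  have [k' a' b'] := double_same_side dP' same'.
  have bb' : (doubled h i).1 = (doubled h' j).1 by rewrite e1.
  move: e1 e2; rewrite b b' [doubled h i]a [doubled h' j]a' bb'.
  case: (doubled h' j).1 => -[e1] [e2].
    exact: (quad_eq cohc dP dP' e2 e1).
  exact: (quad_eq cohc dP dP' e1 e2).
have diff' : (doubled h' j).1 <> (doubled h' (j + d')).1 by rewrite -e1 -e2.
case: h e1 e2 diff => [[b f]|[f k]] //= e1 _ _.
case: h' e1 diff' => [[b' f']|[f' k']] //= -[_ e] _.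
by apply: holes_disjoint e; apply: valP.
Qed.

Lemma twistE :
  [/\ twist 0 = 0, twist 1 = 1, twist 2%:R = 3%:R & twist 3%:R = 2%:R].
Proof. by split; apply/val_inj. Qed.

Lemma double_tube f k : 
  [/\ doubled (inr (f, k)) 0 = (false, c (val f) k),
      doubled (inr (f, k)) 1 = (false, c (val f) (k + 1)),
      doubled (inr (f, k)) 2%:R = (true, c (val f) (k + 3%:R))
    & doubled (inr (f, k)) 3%:R = (true, c (val f) (k + 2%:R))].
Proof.
have [t0 t1 t2 t3] := twistE.
by rewrite /doubled t0 t1 t2 t3 addr0.
Qed.

(** The reverse of a side of [f] is a side of some face of the sphere, hence it
    occurs on each side of the double: in a copy of that face if it is kept,
    in one of the tube faces if it is removed. *)
Lemma double_side_rev b f i : exists h k,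
  doubled h k = (b, c f (if b then i else i + 1)) /\
  doubled h (k + 1) = (b, c f (if b then i + 1 else i)).
Proof.
have [f' [j [e1 e2]]] := quad_rev cohc f i.
have [f'X|f'X] := boolP (f' \in holes).
  case: b.
    have [_ _ t2 t3] := double_tube (exist _ f' f'X) (j + 2%:R).
    exists (inr (exist _ f' f'X, j + 2%:R)), 2%:R.
    by rewrite z4_21 t2 t3 z4_add23 z4_add22 e1 e2.
  have [t0 t1 _ _] := double_tube (exist _ f' f'X) j.
  by exists (inr (exist _ f' f'X, j)), 0; rewrite add0r t0 t1 e1 e2.
exists (inl (b, exist _ f' f'X)), (if b then - j - 1 - 1 else j).
case: b => /=; rewrite -e1 -e2; split=> //; congr (_, c _ _); ring.
Qed.

Lemma double_coherent : coherent_quads doubled.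
Proof.
split.
- case=> [[b f]|[f k]] i j /= [].
    by case: b => /(quad_inj cohc) // /addIr/oppr_inj.
  by move=> _ /(quad_inj cohc)/addrI/twist_inj.
- move=> h h' i j d d' dP dP' e1 e2; have := base_face_eq dP dP' e1 e2.
  case: h h' e1 e2 => [[b f]|[f k]] [[b' f']|[f' k']] /=.
  + by move=> [-> _] _ /val_inj ->.
  + by move=> _ _; case: f f' => f fP [f' f'P] /= ff'; exfalso; case/negP: fP; rewrite ff'.
  + by move=> _ _; case: f f' => f fP [f' f'P] /= ff'; exfalso; case/negP: f'P; rewrite -ff'.
  move=> [s1 e1] [s2 e2] /val_inj ff'; subst f'; congr (inr (_, _)).
  move: e1 e2 => /(quad_inj cohc) e1 /(quad_inj cohc) e2.
  have dk : twist i - twist j = k' - k.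
    by apply/eqP; rewrite subr_eq -(inj_eq (addrI k)) e1; apply/eqP; ring.
  have ij : i = j.
    apply: twist_step s1 s2 _ => //; rewrite dk.
    by apply/esym/eqP; rewrite subr_eq -(inj_eq (addrI k)) e2; apply/eqP; ring.
  by move: dk; rewrite ij subrr => /esym/eqP; rewrite subr_eq0 => /eqP.
case=> [[b f]|[f k]] i.
  have [h [l [e1 e2]]] := double_side_rev b (val f) (if b then - i - 1 - 1 else i).
  exists h, l; rewrite e1 e2 /=; case: b {e1 e2} => //; split; congr (_, c _ _); ring.
have [t0 t1 t2 t3] := double_tube f k.
have [->|->|->|->] : [\/ i = 0, i = 1, i = 2%:R | i = 3%:R].
  by case: i => [[|[|[|[|]]]] // ?];
    [constructor 1|constructor 2|constructor 3|constructor 4]; apply/val_inj.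
(* Sides 0 and 2 of a tube face lie on the boundaries of the tube; side 1 is
   shared with the next tube face, and side 3 with the previous one. *)
- have [h [l [e1 e2]]] := double_side_rev false (val f) k.
  by exists h, l; rewrite e1 e2 add0r t0 t1.
- have [t0' _ _ t3'] := double_tube f (k + 1).
  exists (inr (f, k + 1)), 3%:R.
  by rewrite z4_31 z4_11 t0' t3' t1 t2 z4_add12.
- have [h [l [e1 e2]]] := double_side_rev true (val f) (k + 2%:R).
  by exists h, l; rewrite e1 e2 z4_21 t2 t3 z4_add21.
have [_ t1' t2' _] := double_tube f (k - 1).
exists (inr (f, k - 1)), 1.
by rewrite z4_31 z4_11 t0 t3 t1' t2' subrK z4_addN13.
Qed.

Lemma double_arc b u v : quad_arc c u v -> quad_arc doubled (b, u) (b, v).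
Proof.
case/quad_arcP => f [i [<- <-]].
have [h [k [e1 e2]]] := double_side_rev b f i.
have : quad_arc doubled (doubled h k) (doubled h (k + 1)) by apply/quad_arcP; exists h, k.
by rewrite e1 e2; case: b {e1 e2}; rewrite // quad_arc_sym //; apply: double_coherent.
Qed.

Lemma double_connected : holes != set0 -> (forall u v, connect (quad_arc c) u v) ->
  forall p q, connect (quad_arc doubled) p q.
Proof.
move=> /set0Pn[f fX] conn.
have lift b u v : connect (quad_arc doubled) (b, u) (b, v).
  have /connectP[p pP ->] := conn u v; elim: p u pP => //= x p IH u /andP[ux /IH].
  by apply: connect_trans; apply: connect1; apply: double_arc.
have symc : connect_sym (quad_arc doubled).
  by apply: sym_connect_sym; apply: quad_arc_sym; apply: double_coherent.
have cross u v : connect (quad_arc doubled) (false, u) (true, v).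
  have [_ t1 t2 _] := double_tube (exist _ f fX) 0.
  apply: connect_trans (lift false u (c f (0 + 1))) _.
  apply: connect_trans (lift true (c f (0 + 3%:R)) v); apply/connect1/quad_arcP.
  by exists (inr (exist _ f fX, 0)), 1; rewrite z4_11 t1 t2.
by case=> [[] u] [[] v] //; rewrite symc.
Qed.

Lemma double_has_arc :
  (forall v, exists u, quad_arc c v u) -> forall p, exists q, quad_arc doubled p q.
Proof. by move=> ex [b v]; have [u uv] := ex v; exists (b, u); apply: double_arc. Qed.

Definition opposite u v :=
  [exists f in holes, exists i, (c f i == u) && (c f (i + 2%:R) == v)].

(** The only new neighbour is the vertex opposite in the hole, on the other
    side; it is unique because the holes are disjoint. *)
Lemma double_degree p : (degree_at doubled p <= (degree_at c p.2).+1)%N.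
Proof.
case: p => b u /=; pose N := [set v | quad_arc c u v]; pose A := [set v | opposite u v].
have A1 : (#|A| <= 1)%N.
  apply/card_le1_eqP => x y; rewrite !inE.
  move=> /exists_inP[f fX /existsP[i /andP[/eqP fi /eqP <-]]].
  move=> /exists_inP[f' f'X /existsP[i' /andP[/eqP f'i /eqP <-]]].
  have ff' : f = f' by apply: (holes_disjoint fX f'X) (etrans fi (esym f'i)).
  have ii' : i = i' by apply: (quad_inj cohc (f := f)); rewrite fi -f'i ff'.
  by rewrite ff' ii'.
apply: (@leq_trans #|[set (b, v) | v in N] :|: [set (~~ b, v) | v in A]|); last first.
  apply: leq_trans (leq_card_setU _ _) _; rewrite -addn1 leq_add // ?leq_imset_card //.
  exact: leq_trans (leq_imset_card _ _) A1.
apply: subset_leq_card; apply/subsetP => -[b' v]; rewrite inE => /quad_arcP[h [k [e1 e2]]].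
have [same|diff] := eqVneq (doubled h k).1 (doubled h (k + 1)).1.
  have [//|j] := double_same_side _ same; rewrite e1 e2 => -[fu] [-> fv].
  rewrite inE; apply/orP; left; rewrite imset_f // inE.
  move: fu fv; case: b {e1 e2 same} => -> ->.
    by rewrite quad_arc_sym //; apply/quad_arcP; exists (base_face h), j.
  by apply/quad_arcP; exists (base_face h), j.
have -> : b' = ~~ b by move: diff; rewrite e1 e2 /=; case: (b) (b') => -[].
rewrite inE; apply/orP; right; rewrite imset_f // inE.
case: h e1 e2 diff => [[b1 f]|[f i]]; first by rewrite eqxx.
case=> _ fu [_ fv] /= kP; apply/exists_inP; exists (val f); first exact: valP.
apply/existsP; exists (i + twist k); rewrite fu eqxx -fv; apply/eqP; congr c.
rewrite -addrA; congr (i + _); apply/val_inj; move: kP; clear.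
by case: k => [[|[|[|[|]]]]].
Qed.

Definition swap_side (p : bool * V) := (~~ p.1, p.2).

(** The half turn of the tubes is what makes the exchange of sides act on the
    four tube faces as [i |-> i + 2]. *)
Definition swap_face (h : double_face) : double_face :=
  match h with
  | inl (b, f) => inl (~~ b, f)
  | inr (f, i) => inr (f, i + 2%:R)
  end.

Lemma swap_sideK : involutive swap_side.
Proof. by case=> b v; rewrite /swap_side negbK. Qed.

Lemma swap_double h k : swap_side (doubled h k) = doubled (swap_face h) (- k - 1).
Proof.
case: h => [[b f]|[f i]]; rewrite /swap_side /=.
  by congr (_, c _ _); case: b => //=; ring.
by rewrite side_rev twist_rev addrA z4_add22.
Qed.

Lemma swap_free h i j : swap_side (doubled h i) != doubled h j.
Proof.
apply/eqP; case: h => [[b f]|[f k]] [] /=; first by case: b.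
by move=> side /(quad_inj cohc)/addrI/twist_inj ij; move: side; rewrite ij; case: (2 <= j)%N.
Qed.

Lemma card_double_face : #|double_face| = (2 * (#|F| + #|holes|))%N.
Proof.
have plain : #|{: {f | f \notin holes}}| = #|~: holes|.
  by rewrite card_sig; apply: eq_card => f; rewrite !inE.
have tubes : #|{: {f | f \in holes}}| = #|holes|.
  by rewrite card_sig; apply: eq_card => f; rewrite !inE.
rewrite card_sum !card_prod card_bool card_ord plain tubes -(cardsC holes); lia.
Qed.

End Doubling.

(** * The helix quadrangulation of the sphere *)

Section Helix.
Variable m : nat.

Definition helix_face : finType := ('I_m + 'I_4)%type.

(** The hexagons 0, ..., 5 and m, ..., m + 5, cut by the diagonals from 0 to 3
    and from m + 2 to m + 5.  The diagonals give a third edge to the vertices 0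
    and m + 5, which have only two on the tube. *)
Definition helix_caps : seq (seq nat) :=
  [:: [:: 0; 5; 4; 3]; [:: 0; 3; 2; 1];
      [:: m; m.+1; m.+2; m + 5]; [:: m.+2; m.+3; m + 4; m + 5]]%N.

Definition helix_label (f : helix_face) (k : nat) : nat :=
  match f with
  | inl i => nth 0 [:: i : nat; i.+1; i + 6; i + 5] k
  | inr j => nth 0 (nth [::] helix_caps j) k
  end%N.

Definition helix (f : helix_face) (k : 'I_4) : 'I_(m + 5).+1 := inord (helix_label f k).

Lemma helix_label_lt f (k : 'I_4) : (helix_label f k < (m + 5).+1)%N.
Proof.
case: f k => [i|[[|[|[|[|//]]]] ?]] [[|[|[|[|//]]]] ?] /=; try lia.
all: case: i => i /= ?; lia.
Qed.

Lemma helixE f k : helix f k = helix_label f k :> nat.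
Proof. by rewrite inordK // helix_label_lt. Qed.

(** Corners of one face differ by at most 6. *)
Lemma helix_face_disjoint (i i' : 'I_m) (k k' : 'I_4) : (9 %| i)%N -> (9 %| i')%N ->
  helix (inl i) k = helix (inl i') k' -> i = i'.
Proof.
move=> d d' /(congr1 val); rewrite /= !helixE => e; apply: val_inj => /=.
by case: k k' e => [[|[|[|[|//]]]] ?] [[|[|[|[|//]]]] ?] /=; lia.
Qed.

Hypothesis m_ge5 : (5 <= m)%N.

Definition face_code (f : helix_face) : nat :=
  match f with inl i => i + 4 | inr j => j end%N.

Lemma face_code_inj : injective face_code.
Proof.
case=> i [] j /= e; have := ltn_ord i; have := ltn_ord j => ? ?; try lia.
  by congr inl; apply: val_inj => /=; lia.
by congr inr; apply: val_inj.
Qed.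

(** The code of the face in which [y] comes one or two steps after [x].  The
    difference of the labels tells whether the pair is a side or a diagonal and
    at which place; the inner tests single out the four faces at the ends. *)
Definition decode (x y : nat) : nat :=
  let a := minn x y in
  (if y == x + 1 then (if x < m then x + 4 else if x < m + 2 then 2 else 3)
  else if x == y + 1 then (if y < 3 then 1 else if y < 5 then 0 else y - 1)
  else if y == x + 5 then (if x == 0 then 0 else x + 3)
  else if x == y + 5 then (if y == m then 2 else y + 4)
  else if maxn x y == a + 6 then a + 4
  else if maxn x y == a + 4 then (if a == 0 then 0 else if a == m + 1 then 2 else a + 3)
  else if x + 3 == y then (if x == 0 then 1 else 2)
  else if y + 3 == x then (if y == 0 then 0 else 3)
  else if a == 3 then 0 else if a < 3 then 1 else if a == m then 2 else 3)%N.

Lemma decode_helix f (k d : 'I_4) : d \in [:: 1; 2%:R] ->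
  decode (helix_label f k) (helix_label f (k + d)%R) = face_code f.
Proof.
rewrite !inE => dP.
case: f k => [i|[[|[|[|[|//]]]] ?]] [[|[|[|[|//]]]] ?]; case/orP: dP => /eqP->; rewrite /=.
all: try (case: i => i /= ?).
all: try by [].
all: rewrite /decode; repeat (case: ifP => ?; try lia).
Qed.

Definition helix_arc (x y : nat) : Prop :=
  exists f (k : 'I_4), helix_label f k = x /\ helix_label f (k + 1)%R = y.

Lemma helix_arc_plain (i : nat) (k : 'I_4) x y : (i < m)%N ->
  nth 0%N [:: i; i.+1; i + 6; i + 5]%N k = x ->
  nth 0%N [:: i; i.+1; i + 6; i + 5]%N (k + 1)%R = y -> helix_arc x y.
Proof. by move=> im <- <-; exists (inl (Ordinal im)), k. Qed.

Lemma helix_arc_cap (j k : 'I_4) x y :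
  nth 0%N (nth [::] helix_caps j) k = x ->
  nth 0%N (nth [::] helix_caps j) (k + 1)%R = y -> helix_arc x y.
Proof. by move=> <- <-; exists (inr j), k. Qed.

Lemma helix_arc_up x : (x < m + 5)%N -> helix_arc x x.+1.
Proof.
move=> xm.
have [xm'|] := ltnP x m; first exact: (helix_arc_plain (k := 0) xm').
rewrite leq_eqVlt => /predU1P[<-|]; first exact: (@helix_arc_cap 2%:R 0).
rewrite leq_eqVlt => /predU1P[<-|]; first exact: (@helix_arc_cap 2%:R 1).
rewrite leq_eqVlt => /predU1P[<-|]; first exact: (@helix_arc_cap 3%:R 0).
rewrite leq_eqVlt => /predU1P[<-|x4]; first by apply: (@helix_arc_cap 3%:R 1) => //=; lia.
by apply: (@helix_arc_cap 3%:R 2%:R) => /=; lia.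
Qed.

Lemma helix_arc_down x : (x < m + 5)%N -> helix_arc x.+1 x.
Proof.
case: x => [|[|[|[|[|x]]]]] xm.
- exact: (@helix_arc_cap 1 3%:R).
- exact: (@helix_arc_cap 1 2%:R).
- exact: (@helix_arc_cap 1 1).
- exact: (@helix_arc_cap 0 2%:R).
- exact: (@helix_arc_cap 0 1).
by apply: (@helix_arc_plain x 2%:R) => /=; lia.
Qed.

Lemma helix_arc_add5 x : (x <= m)%N -> helix_arc x (x + 5).
Proof.
case: x => [|x] xm; first exact: (@helix_arc_cap 0 0).
by apply: (@helix_arc_plain x 1) => //=; lia.
Qed.

Lemma helix_arc_sub5 x : (x <= m)%N -> helix_arc (x + 5) x.
Proof.
rewrite leq_eqVlt => /predU1P[->|xm]; first exact: (@helix_arc_cap 2%:R 3%:R).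
exact: (@helix_arc_plain x 3%:R).
Qed.

(** Up to reversal the sides join labels that differ by 1 or 5, apart from the
    diagonals 0, 3 and m + 2, m + 5 of the ends. *)
Lemma helix_arc_rev f (k : 'I_4) :
  helix_arc (helix_label f (k + 1)%R) (helix_label f k).
Proof.
case: f k => [i|[[|[|[|[|//]]]] ?]] [[|[|[|[|//]]]] ?] /=.
all: try (case: i => i /= ?).
- by apply: helix_arc_down; lia.
- by rewrite (_ : i + 6 = i.+1 + 5)%N; [apply: helix_arc_sub5|]; lia.
- by rewrite (_ : i + 6 = (i + 5).+1)%N; [apply: helix_arc_up|]; lia.
- by apply: helix_arc_add5; lia.
- exact: (@helix_arc_sub5 0).
- by apply: helix_arc_up; lia.
- by apply: helix_arc_up; lia.
- exact: (@helix_arc_cap 1 0).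
- exact: (@helix_arc_cap 0 3%:R).
- by apply: helix_arc_up; lia.
- by apply: helix_arc_up; lia.
- by apply: helix_arc_up; lia.
- by apply: helix_arc_down; lia.
- by apply: helix_arc_down; lia.
- exact: (@helix_arc_cap 3%:R 3%:R).
- by apply: helix_arc_add5; lia.
- by apply: helix_arc_down; lia.
- by rewrite (_ : m + 4 = m.+3.+1)%N; [apply: helix_arc_down|]; lia.
- by rewrite (_ : m + 5 = (m + 4).+1)%N; [apply: helix_arc_down|]; lia.
- exact: (@helix_arc_cap 2%:R 2%:R).
Qed.

Lemma helix_label_inj f (k k' : 'I_4) : helix_label f k = helix_label f k' -> k = k'.
Proof.
case: f k k' => [i|[[|[|[|[|//]]]] ?]] [[|[|[|[|//]]]] ?] [[|[|[|[|//]]]] ?] /= e;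
  apply: val_inj; move: e => /=; try done; lia.
Qed.

Lemma helix_coherent : coherent_quads helix.
Proof.
split.
- by move=> f k k' /(congr1 val); rewrite /= !helixE => /helix_label_inj.
- move=> f f' i j d d' dP dP' /(congr1 val) + /(congr1 val); rewrite /= !helixE => e1 e2.
  by apply: face_code_inj; rewrite -(decode_helix f i dP) -(decode_helix f' j dP') e1 e2.
move=> f i; have [f' [j [e1 e2]]] := helix_arc_rev f i.
by exists f', j; rewrite /helix e1 e2.
Qed.

Lemma helix_degree v : (degree_at helix v <= 4)%N.
Proof.
(* The neighbours are v +- 1 and v +- 5 where these exist.  The ends of the two
   diagonals take the place of missing ones; for v = 3 the truncated difference
   v - 5 is already the other end 0. *)
pose s : seq 'I_(m + 5).+1 := map inord
  [:: if v == m + 5 :> nat then m + 2 else v.+1; if v == 0 :> nat then 3 else v.-1;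
      if v == m + 2 :> nat then m + 5 else v + 5; v - 5]%N.
apply: leq_trans (card_size s); apply: subset_leq_card; apply/subsetP => u.
rewrite inE => /quad_arcP[f [k [fk <-]]].
have vE : v = helix_label f k :> nat by rewrite -fk helixE.
rewrite /helix /s map_f // !inE {}vE {fk v s}.
case: f k => [i|[[|[|[|[|//]]]] ?]] [[|[|[|[|//]]]] ?] /=.
all: try (case: i => i /= ?).
all: repeat (case: ifP => ?; try lia).
Qed.

Lemma helix_up (x : nat) : (x < m + 5)%N -> quad_arc helix (inord x) (inord x.+1).
Proof.
case/helix_arc_up=> f [k [e1 e2]]; apply/quad_arcP; exists f, k.
by rewrite /helix e1 e2.
Qed.

Lemma helix_has_arc v : exists u, quad_arc helix v u.
Proof.
have [vm|vm] := ltnP v (m + 5).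
  by exists (inord v.+1); have := helix_up vm; rewrite inord_val.
exists (inord (m + 4)); rewrite quad_arc_sym; last exact: helix_coherent.
have -> : v = inord (m + 4).+1 by apply: val_inj; rewrite /= inordK; have := ltn_ord v; lia.
by apply: helix_up; lia.
Qed.

Lemma helix_connected u v : connect (quad_arc helix) u v.
Proof.
have symc : connect_sym (quad_arc helix).
  by apply: sym_connect_sym => x y; apply: quad_arc_sym; apply: helix_coherent.
suff from0 w : connect (quad_arc helix) (inord 0) w.
  by apply: connect_trans (from0 v); rewrite symc.
rewrite -(inord_val w); elim: (val w) (ltn_ord w) => // x IH xm.
by apply: connect_trans (IH (ltnW xm)) (connect1 (helix_up _)).
Qed.

End Helix.

(** * The map of genus g *)

Local Close Scope ring_scope.

Lemma hole_proof g (j : 'I_g.+1) : 9 * j < 9 * g + 7.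
Proof. by have := ltn_ord j; lia. Qed.

Definition helix_holes g : {set helix_face (9 * g + 7)} :=
  [set inl (Ordinal (hole_proof j)) | j : 'I_g.+1].

Lemma card_helix_holes g : #|helix_holes g| = g.+1.
Proof.
rewrite card_imset ?card_ord // => i j [] e.
by apply: val_inj => /=; lia.
Qed.

Lemma helix_holes_disjoint g :
  {in helix_holes g &, forall f f' i j, helix f i = helix f' j -> f = f'}.
Proof.
move=> _ _ /imsetP[j _ ->] /imsetP[j' _ ->] k k' /helix_face_disjoint e.
by congr inl; apply: e; rewrite /= dvdn_mulr.
Qed.

Theorem theorem1p2 (g : nat) :
  exists (V F : finType) (M : surface_map V F),
    [/\ centrally_symmetric M,
        quadrangulated M,
        on_orientable_surface_of_genus M g
      & #|V| = 18 * g + 26].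
Proof.
have m_ge5 : 5 <= 9 * g + 7 by lia.
pose V : finType := (bool * 'I_(9 * g + 7 + 5).+1)%type.
pose F := double_face (helix_holes g).
pose c : F -> 'I_4 -> V := doubled (@helix (9 * g + 7)) (holes := helix_holes g).
have cohH : coherent_quads (@helix (9 * g + 7)) by apply: helix_coherent.
have holesD := @helix_holes_disjoint g.
have cohc : coherent_quads c by apply: double_coherent.
have cardV : #|V| = 18 * g + 26 by rewrite card_prod card_bool card_ord; lia.
have cardF : #|F| = 20 * g + 24.
  rewrite card_double_face card_helix_holes card_sum !card_ord; lia.
have V0 : 0 < #|V| by rewrite cardV; lia.
have hasc p : exists q, quad_arc c p q.
  by apply: double_has_arc => // v; apply: helix_has_arc.
have [M [ME MB]] : exists M : surface_map V F,
    map_edges M = quad_edges c /\ map_bdry M = quad_bdry c.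
  apply: quad_map_exists => // [|p].
    apply: double_connected => //; first by rewrite -card_gt0 card_helix_holes.
    by move=> u v; apply: helix_connected.
  by apply: leq_trans (double_degree cohH holesD p) _; rewrite ltnS helix_degree.
exists V, F, M; split=> //.
- apply: (quad_map_centrally_symmetric cohc ME MB (t := @swap_face _ _)) => //.
  + exact: swap_sideK.
  + exact: swap_double.
  + by move=> f i j; apply: swap_free.
- exact: quad_map_quadrangulated MB.
split; first by have := quad_map_orientable cohc MB.
rewrite /euler_char ME (card_quad_edges cohc) cardV cardF; lia.
Qed.
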